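(* All finite solvable groups are wexp-solvable; that is, if $G$ is a finite solvable group, then every subgroup of $G$ is weakly exponential with respect to $G$.
   Context: Let $G$ be a finite group. A subgroup $H \le G$ is called weakly exponential with respect to $G$ if, for all $x \in G$, there exists $g \in G$ such that $x^{|G:H|} \in H^g$, where $H^g = g^{-1}Hg$. The group $G$ is called wexp-solvable if every subgroup of $G$ is weakly exponential with respect to $G$. *)

(* Defs.v *)
From mathcomp Require Import all_boot all_fingroup all_solvable.

Set Implicit Arguments.
Unset Strict Implicit.
Unset Printing Implicit Defensive.

Local Open Scope group_scope.

(* [H :^ g] is the set of all g^-1 * h * g with h in H. The condition is only
   meant for H a subgroup of G, which users must require separately. *)
Definition weakly_exponential (gT : finGroupType) (G H : {group gT}) : Prop :=
  forall x, x \in G -> exists2 g, g \in G & x ^+ #|G : H| \in H :^ g.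

Definition wexp_solvable (gT : finGroupType) (G : {group gT}) : Prop :=
  forall H : {group gT}, H \subset G -> weakly_exponential G H.

(* Main.v *)
Require Import Defs.
From mathcomp Require Import all_boot all_fingroup all_solvable.

(** The proof is an induction on the order of G.  Let N be a minimal normal
    subgroup of the solvable group G; it is abelian.  Induction in G / N makes
    H N weakly exponential in G ([weakly_exponential_quotient]), and weak
    exponentiality is transitive because indices multiply
    ([weakly_exponential_trans]); hence induction in H N finishes the proof
    unless G = H N.

    So let G = H N and x \in G, and put K = N <x>.  Since K already contains N,
    K and H have product G, so H meets K in a subgroup of index |G : H|: if K is
    proper in G, induction in K applies to this very exponent.

    There remains the case G = N <x> = H N.  As N is abelian and normal, the
    centraliser of x in N is normal in G, hence by minimality trivial or all of
    N.  If x centralises N then G is abelian and x ^+ |G : H| lies in the normal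
    subgroup H.  Otherwise conjugation by N moves x to every element of its coset
    x N ([conj_lcoset]), and this coset meets H because G = H N: x itself is
    conjugate to an element of H. *)

Set Implicit Arguments.
Unset Strict Implicit.
Unset Printing Implicit Defensive.

Local Open Scope group_scope.

Lemma weakly_exponential_trans (gT : finGroupType) (G M H : {group gT}) :
    H \subset M -> M \subset G ->
  weakly_exponential G M -> weakly_exponential M H -> weakly_exponential G H.
Proof.
move=> sHM sMG wGM wMH x Gx.
have [g Gg] := wGM x Gx; rewrite mem_conjg => My.
have [m Mm] := wMH _ My; rewrite -conjXg -expgM Lagrange_index // => Hz.
exists (m * g); first by rewrite groupM // (subsetP sMG).
by rewrite conjsgM mem_conjg.
Qed.

Lemma weakly_exponential_quotient (gT : finGroupType) (G H N : {group gT}) :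
    N <| G -> N \subset H -> H \subset G ->
  weakly_exponential (G / N) (H / N) -> weakly_exponential G H.
Proof.
move=> nsNG sNH sHG wGH x Gx.
have nNG := normal_norm nsNG; have nNx := subsetP nNG x Gx.
have [_ /morphimP[g nNg Gg ->]] := wGH _ (mem_quotient N Gx).
rewrite index_quotient_eq ?subIset ?sNH ?orbT // -quotientJ //.
rewrite -morphX // => Hx; exists g => //.
have sNHg: N \subset H :^ g by rewrite -(normP nNg) conjSg.
have nsNHg: N <| (H :^ g)%G.
  apply: normalS nsNG => //=.
  by rewrite -(conjGid Gg) conjSg.
by rewrite -(quotientGK nsNHg) mem_morphpre ?groupX.
Qed.

Lemma normal_expg_index (gT : finGroupType) (G H : {group gT}) x :
  H <| G -> x \in G -> x ^+ #|G : H| \in H.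
Proof.
case/andP=> _ nHG Gx; have nHx := subsetP nHG x Gx.
apply: coset_idr; first exact: groupX.
by rewrite morphX // -card_quotient // expg_cardG // mem_quotient.
Qed.

(** The conjugates of x under N all lie in the coset x N, and when no nontrivial
    element of N commutes with x there are |N| of them, so they fill it. *)
Lemma conj_lcoset (gT : finGroupType) (N : {group gT}) x y :
    x \in 'N(N) -> 'C_N[x] = 1 -> y \in x *: N ->
  exists2 n, n \in N & y = x ^ n.
Proof.
move=> nNx regNx xNy.
suffices defxN: x ^: N = x *: N by apply/imsetP; rewrite -/(x ^: N) defxN.
apply/eqP; rewrite eqEcard card_lcoset -index_cent1 regNx indexg1 leqnn andbT.
apply/subsetP=> _ /imsetP[n Nn ->].
rewrite mem_lcoset conjg_mulR mulKg commgEr groupM //.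
by rewrite memJ_norm ?groupV.
Qed.

(** Since N is abelian, every subgroup of N normalised by x is normal in
    G = N <x>; applied to the centraliser of x in N, minimality leaves only the
    two extreme actions of x on N, and each is settled directly. *)
Lemma conj_expg_index_join (gT : finGroupType) (G H N : {group gT}) x :
    minnormal N G -> abelian N -> N \subset G -> H \subset G ->
    H * N = G -> N <*> <[x]> = G ->
  exists2 g, g \in G & x ^+ #|G : H| \in H :^ g.
Proof.
move=> /mingroupP[/andP[_ nNG] minN] abN sNG sHG defHN defNx.
have Gx: x \in G by rewrite -defNx -cycle_subG joing_subr.
have nNx := subsetP nNG x Gx.
have nCG: G \subset 'N('C_N[x]).
  rewrite -defNx join_subG cents_norm ?(sub_abelian_cent2 abN) ?subsetIl //=.
  by rewrite normsI ?(subset_trans _ (normG 'C[x])) ?cycle_subG ?cent1id.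
have [C1 | ntC] := eqVneq 'C_N[x] 1; last first.
  have defC: 'C_N[x] = N by apply: minN; rewrite ?subsetIl ?ntC.
  have abG: abelian G.
    rewrite -defNx abelianY abN cycle_abelian /=.
    by rewrite centsC cent_cycle; apply/setIidPl.
  exists 1 => //; rewrite conjsg1.
  by rewrite normal_expg_index // -sub_abelian_normal.
(* The coset x N contains an element h of H, so h is a conjugate of x. *)
have: x \in H * N by rewrite defHN.
case/mulsgP=> h n Hh Nn defx.
have [|m Nm defh] := @conj_lcoset _ N x h nNx C1.
  by rewrite mem_lcoset defx invMg mulgKV groupV.
exists m^-1; first by rewrite groupV (subsetP sNG).
by rewrite mem_conjgV conjXg -defh groupX.
Qed.

Theorem theorem1p8 (gT : finGroupType) (G : {group gT}) :
  solvable G -> wexp_solvable G.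
Proof.
have [n] := ubnP #|G|; elim: n => // n IHn in gT G *.
rewrite ltnS => leGn solG H sHG.
have [-> | ntG] := eqVneq G 1%G.
  by move=> x /set1P->; exists 1; rewrite ?expg1n ?conjsg1.
have [N minN sNG] := minnormal_exists ntG (normG G).
have [nNG ntN /is_abelemP[p _ /abelem_abelian abN]] :=
  minnormal_solvable minN sNG solG.
have nNH := subset_trans sHG nNG.
have defHN: H <*> N = H * N by apply: norm_joinEl.
have sHNG: H <*> N \subset G by rewrite join_subG sHG.
have wHN: weakly_exponential G (H <*> N).
  apply: (@weakly_exponential_quotient _ G (H <*> N)%G N) => //.
  - by apply/andP.
  - exact: joing_subr.
  apply: IHn; rewrite ?quotient_sol ?quotientS //.
  exact: leq_trans (ltn_quotient ntN sNG) leGn.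
have [ltHNG | eqHNG] := boolP (H <*> N \proper G).
  have wH: weakly_exponential (H <*> N) H.
    apply: IHn; last exact: joing_subl.
      exact: leq_trans (proper_card ltHNG) leGn.
    exact: solvableS solG.
  exact: weakly_exponential_trans (joing_subl H N) sHNG wHN wH.
have defG: H * N = G.
  by apply/eqP; rewrite -defHN eqEproper sHNG.
move=> x Gx; set K := (N <*> <[x]>)%G.
have sKG: K \subset G by rewrite join_subG sNG cycle_subG.
have [ltKG | eqKG] := boolP (K \proper G); last first.
  apply: (conj_expg_index_join minN) => //.
  by apply/eqP; rewrite eqEproper sKG.
have defHK: H * K = G.
  apply/eqP; rewrite eqEsubset mul_subG //= -{1}defG mulgS //.
  exact: joing_subl.
(* Both indices equal |H K| / |H|, since H K = G. *)
have indexHK: #|K : H :&: K| = #|G : H|.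
  apply/eqP; rewrite -(eqn_pmul2l (cardG_gt0 (H :&: K))) Lagrange ?subsetIr //.
  rewrite -(eqn_pmul2l (cardG_gt0 H)) mul_cardG defHK -(Lagrange sHG).
  by rewrite mulnC mulnCA.
have [||||g Kg Hxg] := IHn _ K _ _ (H :&: K)%G _ x.
- exact: leq_trans (proper_card ltKG) leGn.
- exact: solvableS solG.
- exact: subsetIr.
- by rewrite -cycle_subG joing_subr.
exists g; first exact: (subsetP sKG).
by rewrite -indexHK; apply: subsetP Hxg; rewrite conjSg subsetIl.
Qed.
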